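(* Let $n\ge 2$, $K=(n^2-n)/2$, $0<p\le 1/2$, $q=1-p$, $\epsilon\ge 0$ and $r=1+\epsilon$. Let $\mathbf{D}$ be a random directed graph on $\{1,\dots,n\}$ in which each of the $n(n-1)$ possible arcs $(i,j)$, $i\ne j$, is present independently with probability $p$; let $\mathbf{X}$ be the number of arcs $(i,j)$ with $j>i$ and $\mathbf{Y}$ the number of arcs $(i,j)$ with $i>j$ (so $\mathbf{X},\mathbf{Y}$ are independent with binomial distribution $B(K,p)$). Then $$\Pr(\mathbf{X}-r\mathbf{Y}\ge 0)\le \exp\left(-\frac{p}{2q}\,\frac{K\epsilon^2}{1+r^2}\right).$$ *)

(* Defs.v *)
From mathcomp Require Import all_boot all_order all_algebra.
From mathcomp Require Import all_classical all_reals all_analysis.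

Set Implicit Arguments.
Unset Strict Implicit.
Unset Printing Implicit Defensive.

Import Order.TTheory GRing.Theory Num.Theory.

Local Open Scope classical_set_scope.
Local Open Scope ring_scope.

Definition possible_arcs (n : nat) : {set 'I_n * 'I_n} :=
  [set a : 'I_n * 'I_n | a.1 != a.2]%SET.

(* Only the events E i with i \in J matter; the product rule is required for
   every subfamily B of J. *)
Definition mutually_independent (R : realType) (d : measure_display)
    (T : measurableType d) (P : probability T R) (I : finType) (J : {set I})
    (E : I -> set T) : Prop :=
  (forall i, i \in J -> measurable (E i)) /\
  (forall B : {set I}, B \subset J ->
     P (\bigcap_(i in [set` B]) E i) = (\prod_(i in B) P (E i))%E).

(* A digraph on 'I_n is represented by its set of arcs. *)
Definition arc_event (T : Type) (n : nat) (D : T -> {set 'I_n * 'I_n})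
    (a : 'I_n * 'I_n) : set T := [set w | a \in D w].

Definition random_digraph (R : realType) (d : measure_display)
    (T : measurableType d) (P : probability T R) (n : nat) (p : R)
    (D : T -> {set 'I_n * 'I_n}) : Prop :=
  [/\ (forall w, D w \subset possible_arcs n),
      (forall a, a \in possible_arcs n -> P (arc_event D a) = p%:E)
    & mutually_independent P (possible_arcs n) (arc_event D)].

Definition forward_arcs (n : nat) (G : {set 'I_n * 'I_n}) : nat :=
  #|[set a in G | (a.1 < a.2)%N]%SET|.

Definition backward_arcs (n : nat) (G : {set 'I_n * 'I_n}) : nat :=
  #|[set a in G | (a.2 < a.1)%N]%SET|.

(* Main.v *)
(* Chernoff's method with t = eps / (q (1 + r^2)), the optimal exponent for a Gaussian
   variable with the mean and variance of X - r Y.  Since X - r Y is a sum of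
   independent arc scores, it suffices that
     (q + p e^t) (q + p e^(-rt)) <= e^(- p eps t / 2),
   which is shown in two regimes.  For p <= 1/3, Padé approximants of exp reduce it to
   a polynomial inequality, using only 1 + x <= e^x.  For p >= 1/3, the ratio of the
   centred Bernoulli moment generating function at -u to the Gaussian one of the same
   variance is nonincreasing in u >= 0, so that rt may be replaced by t at no loss; what
   remains is 1 + 2pq (cosh t - 1) <= e^(pq t^2), where the comparison of the fourth-order
   terms needs 2pq >= 1/3. *)
Require Import Defs.
From mathcomp Require Import all_boot all_order all_algebra ring lra.
From mathcomp Require Import all_classical all_reals all_analysis.

Import Order.TTheory GRing.Theory Num.Theory.
Import numFieldNormedType.Exports.

Local Open Scope classical_set_scope.
Local Open Scope ring_scope.

(** * Rational bounds for the exponential *)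

Lemma is_derive_MVT {R : realType} {f df : R -> R} {a b : R} :
  a <= b -> (forall x : R, is_derive x 1 f (df x)) ->
  exists2 c, a <= c <= b & f b - f a = df c * (b - a).
Proof.
move=> ab fdf; apply: (MVT_segment ab (fun x _ => fdf x)).
apply: continuous_subspaceT => x.
by apply/differentiable_continuous/derivable1_diffP; have [] := fdf x.
Qed.

(* The difference of the two sides is convex in [x], with a critical zero at 0. *)
Lemma expR_ge_pade {R : realType} (x : R) :
  6 + 2 * x <= (6 - 4 * x + x ^+ 2) * expR x.
Proof.
pose F (y : R) : R := (6 - 4 * y + y ^+ 2) * expR y - (6 + 2 * y).
pose G (y : R) : R := (2 - 2 * y + y ^+ 2) * expR y - 2.
have dG (y : R) : is_derive y 1 G (y ^+ 2 * expR y).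
  by apply: is_derive_eq; rewrite /GRing.scale /=; ring.
have dF (y : R) : is_derive y 1 F (G y).
  by apply: is_derive_eq; rewrite /GRing.scale /= /G; ring.
have dG0 y : 0 <= y ^+ 2 * expR y by rewrite mulr_ge0 ?sqr_ge0 ?expR_ge0.
have G0 : G 0 = 0 by rewrite /G expR0; ring.
have F0 : F 0 = 0 by rewrite /F expR0; ring.
rewrite -subr_ge0 -/(F x) -F0.
have G_homo a b : a <= b -> G a <= G b.
  move=> ab; have [c _ Gab] := is_derive_MVT ab dG.
  by rewrite -subr_ge0 Gab mulr_ge0 ?subr_ge0 ?dG0.
have [x0|/ltW x0] := leP 0 x.
  have [c /andP[c0 _] Fx] := is_derive_MVT x0 dF.
  rewrite -subr_ge0 Fx; apply: mulr_ge0; last by rewrite subr_ge0.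
  by rewrite -G0 G_homo.
have [c /andP[_ c0] Fx] := is_derive_MVT x0 dF.
rewrite -subr_le0 Fx; apply: mulr_le0_ge0; last by rewrite subr_ge0.
by rewrite -G0 G_homo.
Qed.

Lemma expR_le_pade {R : realType} (t : R) : t < 3 ->
  expR t <= (6 + 4 * t + t ^+ 2) / (6 - 2 * t).
Proof.
move=> t3; rewrite ler_pdivlMr; last by lra.
have := expR_ge_pade (- t); rewrite expRN ler_pdivlMr ?expR_gt0//; lra.
Qed.

(** * Moment generating function of one pair of opposite arcs *)

Lemma mgf_small_p {R : realType} (p eps t : R) :
  0 < p -> p <= 1 / 3 -> 0 <= eps -> 0 <= t -> t <= 1 / 2 ->
  t * ((1 - p) * (1 + (1 + eps) ^+ 2)) = eps ->
  (1 - p + p * expR t) * (1 - p + p * expR (- ((1 + eps) * t)))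
    <= expR (- (p * eps * t / 2)).
Proof.
move=> p0 p3 e0 t0 t2 tE.
apply: le_trans (expR_ge1Dx _).
set u := (1 + eps) * t.
have u0 : 0 <= u by rewrite mulr_ge0//; lra.
have At := @expR_le_pade _ t ltac:(lra).
have Au := @expR_le_pade _ (- u) ltac:(lra).
have := expR_ge0 t; have := expR_ge0 (- u) => eu0 et0.
apply: (@le_trans _ _ ((1 - p + p * ((6 + 4 * t + t ^+ 2) / (6 - 2 * t)))
   * (1 - p + p * ((6 + 4 * (- u) + (- u) ^+ 2) / (6 - 2 * (- u)))))).
  by apply: ler_pM; [nra|nra|rewrite lerD2l ler_pM2l|rewrite lerD2l ler_pM2l].
have w0 : 0 < (6 - 2 * t) * (6 + 2 * u) by rewrite mulr_gt0//; lra.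
rewrite -subr_ge0 -(pmulr_lge0 _ w0).
(* By the choice of [t], all terms of order less than 4 in [(t, eps)] cancel. *)
have -> : (1 + - (p * eps * t / 2) -
  (1 - p + p * ((6 + 4 * t + t ^+ 2) / (6 - 2 * t))) *
  (1 - p + p * ((6 + 4 * - u + (- u) ^+ 2) / (6 - 2 * - u)))) *
  ((6 - 2 * t) * (6 + 2 * u)) =
  18 * p * t * (eps - t * ((1 - p) * (1 + (1 + eps) ^+ 2)))
  + p * t ^+ 2 * (eps ^+ 2 * (6 - 18 * p) + (1 + eps) * eps * t * (4 - 6 * p)
     - p * (1 + eps) ^+ 2 * t ^+ 2).
  by rewrite /u; field; apply/andP; split; apply: lt0r_neq0; rewrite -/u; lra.
rewrite tE subrr mulr0 add0r mulr_ge0//; first by rewrite mulr_ge0 ?sqr_ge0// ltW.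
have r1 : 1 <= 1 + eps by lra.
set r := 1 + eps in tE r1 *.
(* The coefficient [6 - 18 * p] changes sign at p = 1/3, the limit of this regime. *)
have H1 : 0 <= eps ^+ 2 * (6 - 18 * p) by rewrite mulr_ge0 ?sqr_ge0//; lra.
have H2 : r * eps * t * 2 <= r * eps * t * (4 - 6 * p).
  by rewrite ler_wpM2l//; [rewrite !mulr_ge0//; lra|lra].
(* Substituting eps = t q (1 + r^2) reduces this to p <= 2q and r^2 <= r (1 + r^2). *)
have H3 : p * r ^+ 2 * t ^+ 2 <= r * eps * t * 2.
  rewrite -tE.
  rewrite (_ : r * _ * t * 2 = 2 * (1 - p) * (r * (1 + r ^+ 2)) * t ^+ 2); last by ring.
  rewrite ler_wpM2r ?sqr_ge0//; apply: ler_pM; [lra|by rewrite sqr_ge0|lra|].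
  by rewrite expr2 ler_wpM2l//; [lra|nra].
lra.
Qed.

(* The constant 18 (instead of 24) is the smallest for which the bound is still good
   enough when [2pq >= 4/9], that is, when [p >= 1/3]. *)
Lemma cosh_le {R : realType} (t : R) : 0 <= t <= 1 / 2 ->
  (expR t + expR (- t)) / 2 <= 1 + t ^+ 2 / 2 + t ^+ 4 / 18.
Proof.
(* Padé bounds at [t] itself give t^2/2 / (1 - t^2/9), too large at sixth order. The doubling
   formula cosh t = 2 (cosh s)^2 - 1 lowers the fourth-order coefficient and leaves room. *)
move=> /andP[t0 t2]; pose s := t / 2.
have [s0 s4] : 0 <= s /\ s <= 1 / 4 by rewrite /s; lra.
have ss : s ^+ 2 <= 1 / 16 by rewrite expr2; nra.
pose c := (expR s + expR (- s)) / 2 - 1.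
have -> : (expR t + expR (- t)) / 2 = 1 + 4 * c + 2 * c ^+ 2.
  have -> : t = s + s by rewrite /s; lra.
  have e1 : expR s * expR (- s) = 1 by rewrite expRxMexpNx_1.
  rewrite opprD !expRD /c; by field: e1.
have c0 : 0 <= c.
  have := expR_ge1Dx s; have := expR_ge1Dx (- s); rewrite /c; lra.
have cs : c <= s ^+ 2 * (9 / 2) / (9 - s ^+ 2).
  have h1 := @expR_le_pade _ s ltac:(lra).
  have h2 := @expR_le_pade _ (- s) ltac:(lra).
  have -> : s ^+ 2 * (9 / 2) / (9 - s ^+ 2) =
    ((6 + 4 * s + s ^+ 2) / (6 - 2 * s) +
     (6 + 4 * (- s) + (- s) ^+ 2) / (6 - 2 * (- s))) / 2 - 1.
    by field; apply/and3P; split; apply: lt0r_neq0; lra.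
  rewrite /c; lra.
(* The remainder is s^4 / (2 (9 - s^2)), and 9 - s^2 >= 143/16. *)
have cs' : c <= s ^+ 2 / 2 + s ^+ 4 * (8 / 143).
  apply: le_trans cs _; rewrite ler_pdivrMr; last by lra.
  rewrite (_ : s ^+ 4 = s ^+ 2 * s ^+ 2); last by ring.
  have := sqr_ge0 s; set z := s ^+ 2 in ss *; nra.
have tE : t = 2 * s by rewrite /s; lra.
have [-> ->] : t ^+ 2 = 4 * s ^+ 2 /\ t ^+ 4 = 16 * (s ^+ 2 * s ^+ 2).
  by split; rewrite tE; ring.
rewrite (_ : s ^+ 4 = s ^+ 2 * s ^+ 2) in cs'; last by ring.
have := sqr_ge0 s; move: ss cs'; set z := s ^+ 2 => ss cs' z0.
have c2 : c ^+ 2 <= (z / 2 * (1 + 1 / 143)) ^+ 2.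
  rewrite ler_sqr ?nnegrE//; nra.
nra.
Qed.

(** The trapezoid rule overestimates the integral of the convex function exp(-x) over [0, u]. For u
    < 2 the proof uses the equivalent form (2 - u) exp(u) <= 2 + u. *)
Lemma expRN_mean_ge {R : realType} (u : R) : 0 <= u ->
  1 - expR (- u) <= u * ((1 + expR (- u)) / 2).
Proof.
move=> u0; have [u3|u3] := ltP u 2; last first.
  have := expR_ge0 (- u); nra.
have := @expR_le_pade _ u ltac:(lra); rewrite ler_pdivlMr; last by lra.
have := expR_gt0 u; rewrite expRN.
set e := expR u => e0 H.
rewrite -subr_ge0 -(pmulr_lge0 _ e0).
have -> : (u * ((1 + e^-1) / 2) - (1 - e^-1)) * e = (u * (e + 1) - 2 * (e - 1)) / 2.
  by field; apply: lt0r_neq0.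
nra.
Qed.

(* [exp(pu - pqu^2/2) (q + p exp(-u))] compares the moment generating function
   of a centred Bernoulli variable at [-u] to that of the Gaussian variable with
   the same variance. *)
Lemma bernoulli_gauss_ratio_nincr {R : realType} (p t u : R) :
  0 <= p -> p <= 1 / 2 -> 0 <= t -> t <= u ->
  expR (p * u - p * (1 - p) * (u ^+ 2 / 2)) * (1 - p + p * expR (- u)) <=
  expR (p * t - p * (1 - p) * (t ^+ 2 / 2)) * (1 - p + p * expR (- t)).
Proof.
move=> p0 p2 t0 tu.
pose M (x : R) : R :=
  expR (p * x - p * (1 - p) * (x ^+ 2 / 2)) * (1 - p + p * expR (- x)).
pose dM (x : R) : R := expR (p * x - p * (1 - p) * (x ^+ 2 / 2)) *
  (p * (1 - p)) * (1 - expR (- x) - x * (1 - p + p * expR (- x))).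
have MdM x : is_derive (x : R) 1 M (dM x).
  by apply: is_derive_eq; rewrite /GRing.scale /= /dM; field.
have [x /andP[tx _] MM] := is_derive_MVT tu MdM.
rewrite -subr_le0 MM; apply: mulr_le0_ge0; last by rewrite subr_ge0.
apply: mulr_ge0_le0; first by rewrite !mulr_ge0 ?expR_ge0//; lra.
(* This settles p = 1/2. A smaller [p] only increases 1 - p + p exp(-x), by (1/2 - p) (1 -
   exp(-x)). *)
have := expRN_mean_ge _ (le_trans t0 tx).
have x0 := le_trans t0 tx.
have : expR (- x) <= 1 by rewrite -expR0 ler_expR oppr_le0.
set e := expR (- x) => e1 He.
have : 0 <= x * ((1 / 2 - p) * (1 - e)) by rewrite !mulr_ge0//; lra.
lra.
Qed.

Lemma mgf_large_p {R : realType} (p eps t : R) :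
  1 / 3 <= p -> p <= 1 / 2 -> 0 <= eps -> 0 <= t -> t <= 1 / 2 ->
  t * ((1 - p) * (1 + (1 + eps) ^+ 2)) = eps ->
  (1 - p + p * expR t) * (1 - p + p * expR (- ((1 + eps) * t)))
    <= expR (- (p * eps * t / 2)).
Proof.
move=> p3 p2 e0 t0 t2 tE.
have p0 : 0 <= p by lra.
set u := (1 + eps) * t; set v := p * (1 - p).
have tu : t <= u by rewrite /u; nra.
have v49 : 4 / 9 <= 2 * v by rewrite /v; nra.
have := bernoulli_gauss_ratio_nincr _ _ _ p0 p2 t0 tu.
rewrite -/v -ler_pdivlMl ?expR_gt0// -expRN => Hu.
have q0 : 0 <= 1 - p + p * expR t by have := expR_ge0 t; nra.
apply: le_trans (ler_wpM2l q0 Hu) _.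
have sym : (1 - p + p * expR t) * (1 - p + p * expR (- t)) <= expR (v * t ^+ 2).
  (* The quadratic Taylor polynomial of exp, a lower bound by [expR_ge_pade], separates the two
     sides. *)
  apply: (@le_trans _ _ (1 + v * t ^+ 2 + (v * t ^+ 2) ^+ 2 / 2)); last first.
    have z0 : 0 <= v * t ^+ 2 by rewrite mulr_ge0 ?sqr_ge0//; lra.
    have z1 : v * t ^+ 2 <= 1 by rewrite /v; nra.
    have := expR_ge_pade (v * t ^+ 2).
    set z := v * t ^+ 2 in z0 z1 *.
    have w0 : 0 < 6 - 4 * z + z ^+ 2 by nra.
    rewrite -(ler_pdivrMl _ _ w0); apply: le_trans.
    rewrite ler_pdivlMl// -subr_ge0.
    rewrite (_ : _ - _ = z ^+ 3 * (1 - z / 2)); last by field.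
    by rewrite mulr_ge0 ?exprn_ge0//; lra.
  have e1 : expR t * expR (- t) = 1 by rewrite expRxMexpNx_1.
  have -> : (1 - p + p * expR t) * (1 - p + p * expR (- t)) =
     1 + 2 * v * ((expR t + expR (- t)) / 2 - 1) by rewrite /v; field: e1.
  (* At fourth order, v/9 <= v^2/2 is needed, which is [v49]. *)
  have := @cosh_le _ t; rewrite t0 t2 => /(_ isT) ch.
  nra.
rewrite mulrCA [X in _ * X]mulrCA mulrA.
apply: le_trans (ler_wpM2l _ sym) _.
  by rewrite mulr_ge0 ?expR_ge0.
rewrite -!expRD ler_expR le_eqVlt; apply/orP; left; apply/eqP.
(* The exponents add up to p (t - u) + v (t^2 + u^2) / 2 with u = r t. *)
transitivity (- (p * t * eps)
  + p * t / 2 * (t * ((1 - p) * (1 + (1 + eps) ^+ 2)))).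
  by rewrite /u /v; field.
by rewrite tE; field.
Qed.

(** The two factors belong to opposite arcs, of scores 1 and -r; the K-th power of this bound is the
    Chernoff bound. *)
Lemma mgf_le {R : realType} {p eps t : R} :
  0 < p -> p <= 1 / 2 -> 0 <= eps -> 0 <= t ->
  t * ((1 - p) * (1 + (1 + eps) ^+ 2)) = eps ->
  (1 - p + p * expR t) * (1 - p + p * expR (- ((1 + eps) * t)))
    <= expR (- (p * eps * t / 2)).
Proof.
move=> p0 p2 e0 t0 tE.
(* Since q >= 1/2 and (eps - 1)^2 >= 0, t (2 eps + 1/2) <= eps. *)
have t2 : t <= 1 / 2.
  have v_ge : 2 * eps + 1 / 2 <= (1 - p) * (1 + (1 + eps) ^+ 2).
    have e1 := sqr_ge0 (eps - 1).
    have : (1 / 2) * (1 + (1 + eps) ^+ 2) <= (1 - p) * (1 + (1 + eps) ^+ 2).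
      by rewrite ler_wpM2r//; [rewrite addr_ge0 ?sqr_ge0|lra].
    lra.
  have := ler_wpM2l t0 v_ge; rewrite tE; nra.
have [p3|/ltW p3] := leP p (1 / 3).
  exact: mgf_small_p.
exact: mgf_large_p.
Qed.

(** * Counting forward and backward arcs *)

Lemma card_forward_backward (n : nat) :
  #|[set a : 'I_n * 'I_n | (a.2 < a.1)%N]%SET| =
  #|[set a : 'I_n * 'I_n | (a.1 < a.2)%N]%SET|.
Proof.
rewrite -[RHS](card_imset _ (can_inj (@swap_pairK _ _))).
apply: eq_card => -[i j]; rewrite inE /=; apply/idP/imsetP => [ij|[[k l]]].
  by exists (j, i); rewrite ?inE.
by rewrite inE /= => kl [-> ->].
Qed.

Lemma card_forward {R : realType} (n : nat) :
  #|[set a : 'I_n * 'I_n | (a.1 < a.2)%N]%SET|%:R = (n%:R ^+ 2 - n%:R) / 2 :> R.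
Proof.
have diag : #|[set a : 'I_n * 'I_n | a.1 == a.2]%SET| = n.
  rewrite -[RHS]card_ord -(card_imset _ (_ : injective (fun i : 'I_n => (i, i)))).
    apply: eq_card => -[i j]; rewrite !inE /=.
    by apply/eqP/imsetP => [->|[k _ [-> ->]]//]; exists j.
  by move=> i j [].
have : (#|[set a : 'I_n * 'I_n | (a.1 < a.2)%N]%SET| +
        #|[set a : 'I_n * 'I_n | (a.2 < a.1)%N]%SET| +
        #|[set a : 'I_n * 'I_n | a.1 == a.2]%SET| = n ^ 2)%N.
  rewrite -!sum1_card !(big_mkcond (fun a => a \in _)) -!big_split /=.
  rewrite (eq_bigr (fun=> 1%N)).
    by rewrite sum1_card card_prod card_ord mulnn.
  by move=> a _; rewrite !inE -val_eqE; case: ltngtP.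
rewrite card_forward_backward diag => /(congr1 (fun k => k%:R : R)).
rewrite !natrD natrX; lra.
Qed.

(** * The law of the random digraph *)

(** Induction on the number of complements: one is removed by P(U \ E_c) = P(U) - P(U and E_c),
    until the product rule applies. *)
Lemma independent_cylinder {R : realType} {d : measure_display}
    {T : measurableType d} {P : probability T R} {I : finType} {J : {set I}}
    {E : I -> set T} {p : R} :
  mutually_independent P J E -> (forall i, i \in J -> P (E i) = p%:E) ->
  forall B C : {set I}, B \subset J -> C \subset J -> [disjoint B & C]%B ->
  P (\bigcap_(i in [set` B]) E i `&` \bigcap_(i in [set` C]) ~` E i) =
  (p ^+ #|B| * (1 - p) ^+ #|C|)%:E.
Proof.
move=> [mE indE] PE B C.
have mB (A : {set I}) : A \subset J -> measurable (\bigcap_(i in [set` A]) E i).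
  move=> /fintype.subsetP AJ; apply: fin_bigcap_measurable; first exact: finite_finset.
  by move=> i /AJ; exact: mE.
have mC (A : {set I}) : A \subset J -> measurable (\bigcap_(i in [set` A]) ~` E i).
  move=> /fintype.subsetP AJ; apply: fin_bigcap_measurable; first exact: finite_finset.
  by move=> i /AJ; move/mE; exact: measurableC.
move Ek: #|C| => k; elim: k B C Ek => [|k IH] B C Ek BJ CJ BC.
  rewrite (cards0_eq Ek) (_ : [set` finset.set0] = set0); last first.
    by rewrite -subset0 => i /=; rewrite inE.
  rewrite bigcap_set0 setIT indE// expr0 mulr1.
  rewrite (eq_bigr (fun=> p%:E)); last by move=> i /(fintype.subsetP BJ); exact: PE.
  by rewrite prodEFin prodr_const.
have /card_gt0P[c cC] : (0 < #|C|)%N by rewrite Ek.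
have cJ := fintype.subsetP CJ _ cC.
pose C' := (C :\ c)%SET.
have C'k : #|C'| = k by move: Ek; rewrite (cardsD1 c) cC => -[].
have C'J : C' \subset J := fintype.subset_trans (subD1set _ _) CJ.
have cB : c \notin B by apply: contraTN cC => cB; rewrite (disjointFr BC).
have BC' : [disjoint B & C']%B by apply: disjointWr BC; exact: subD1set.
have cBC' : [disjoint (c |: B)%SET & C']%B.
  apply/pred0P => i /=; rewrite in_setU1; have [->|_] /= := eqVneq i c.
    by rewrite !inE eqxx.
  by case iB: (i \in B) => //=; rewrite (disjointFr BC').
have CE : [set` C] = c |` [set` C'].
  apply/seteqP; split => i /=; rewrite in_setD1.
    by have [->|_ ?] := eqVneq i c; [left|right].
  by move=> [->//|/andP[]].
have BE : [set` (c |: B)%SET] = c |` [set` B].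
  apply/seteqP; split => i /=; rewrite in_setU1.
    by move=> /orP[/eqP|]; [left|right].
  by move=> [->|->]; rewrite ?eqxx ?orbT.
pose U := \bigcap_(i in [set` B]) E i `&` \bigcap_(i in [set` C']) ~` E i.
have mU : measurable U := measurableI _ _ (mB _ BJ) (mC _ C'J).
rewrite CE bigcap_setU1 setICA setIC -setDE -/U.
transitivity (P U - P (U `&` E c))%E.
  apply: measureD (mE _ cJ) _ => //.
  by rewrite (le_lt_trans (probability_le1 _ mU)) ?ltry.
rewrite {1}/U IH// /U setIC setIA -bigcap_setU1 -BE IH//; last first.
  apply/fintype.subsetP => i; rewrite !inE => /orP[/eqP->//|].
  exact: (fintype.subsetP BJ).
rewrite cardsU1 cB -EFinB; congr (_%:E); rewrite exprD expr1 exprS; ring.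
Qed.

Lemma union_bound {R : realType} {d : measure_display} {T : measurableType d}
    (P : probability T R) {I : finType} (A : pred I) (F : I -> set T) :
  (forall i, A i -> measurable (F i)) ->
  (P (\bigcup_(i in [set` A]) F i) <= \sum_(i | A i) P (F i))%E.
Proof.
move=> mF; rewrite bigcup_pred.
suff [] : measurable (\big[setU/set0]_(i in A) F i) /\
  (P (\big[setU/set0]_(i in A) F i) <= \sum_(i in A) P (F i))%E by [].
apply: (big_ind2 (fun (X : set T) y => measurable X /\ (P X <= y)%E)).
- by rewrite measure0.
- move=> X x Y y [mX Xx] [mY Yy]; split; first exact: measurableU.
  exact: le_trans (measureU2 _ mX mY) (leeD Xx Yy).
- by move=> i /mF; split.
Qed.

(** As [D] only has possible arcs, the event D = G is a cylinder: the arcs of [G] occur and the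
    other possible ones do not. *)
Lemma digraph_law {R : realType} {d : measure_display} {T : measurableType d}
    {P : probability T R} {n : nat} {p : R} {D : T -> {set 'I_n * 'I_n}}
    {G : {set 'I_n * 'I_n}} :
  random_digraph P p D -> G \subset possible_arcs n ->
  measurable [set w | D w = G] /\
  P [set w | D w = G] =
    (p ^+ #|G| * (1 - p) ^+ #|possible_arcs n :\: G|)%:E.
Proof.
move=> [DJ PE indE] GJ; set J := possible_arcs n in DJ PE indE GJ *.
have JGJ : (J :\: G)%SET \subset J by exact: subsetDl.
have -> : [set w | D w = G] =
  \bigcap_(a in [set` G]) arc_event D a `&`
  \bigcap_(a in [set` (J :\: G)%SET]) ~` arc_event D a.
  apply/seteqP; split => [w <-|w [inG notG]].
    by split => a //=; rewrite inE => /andP[/negP].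
  apply/setP => a; apply/idP/idP => [aD|/inG//].
  apply/negPn/negP => aG; apply: (notG a) => //=.
  by rewrite inE aG (fintype.subsetP (DJ w)).
split.
  apply: measurableI; apply: fin_bigcap_measurable => // a /=.
    by move=> /(fintype.subsetP GJ); exact: indE.1.
  by move=> /(fintype.subsetP JGJ) aJ; apply: measurableC; exact: indE.1.
apply: (independent_cylinder indE PE) => //.
by apply/pred0P => a /=; rewrite inE; case: (a \in G).
Qed.

(** * Factorisation over the arcs *)

Lemma prod_forward_backward {R : comRingType} (n : nat) (x y : R) :
  \prod_(a : 'I_n * 'I_n) (if (a.1 < a.2)%N then x else
    if (a.2 < a.1)%N then y else 1) =
  (x * y) ^+ #|[set a : 'I_n * 'I_n | (a.1 < a.2)%N]%SET|.
Proof.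
rewrite exprMn -{2}card_forward_backward -!prodr_const.
rewrite (big_mkcond (fun a => a \in _)) [X in _ = _ * X]big_mkcond -big_split /=.
by apply: eq_bigr => a _; rewrite !inE; case: ltngtP; rewrite ?mulr1 ?mul1r.
Qed.

Lemma arc_score_sum {R : comRingType} (n : nat) (r : R) (G : {set 'I_n * 'I_n}) :
  \sum_(a in G) ((a.1 < a.2)%N%:R - r * (a.2 < a.1)%N%:R) =
  (forward_arcs G)%:R - r * (backward_arcs G)%:R.
Proof.
rewrite sumrB -mulr_sumr -!natr_sum /forward_arcs /backward_arcs.
have card_cond (Q : pred ('I_n * 'I_n)) :
  (\sum_(a in G) Q a)%N = #|[set a in G | Q a]%SET|.
  rewrite -sum1_card big_mkcond [RHS]big_mkcond /=; apply: eq_bigr => a _.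
  by rewrite inE; case: (a \in G); case: (Q a).
by rewrite (card_cond (fun a => a.1 < a.2)%N) (card_cond (fun a => a.2 < a.1)%N).
Qed.

(* [\sum_G Pr(D = G) exp(t (X(G) - r Y(G)))] is the moment generating function of
   [X - r Y]; by independence it factors over the arcs. *)
Lemma digraph_mgf {R : realType} (n : nat) (p r t : R) :
  \sum_(G : {set 'I_n * 'I_n} | G \subset possible_arcs n)
    p ^+ #|G| * (1 - p) ^+ #|possible_arcs n :\: G| *
    expR (t * ((forward_arcs G)%:R - r * (backward_arcs G)%:R)) =
  ((1 - p + p * expR t) * (1 - p + p * expR (- (r * t)))) ^+
    #|[set a : 'I_n * 'I_n | (a.1 < a.2)%N]%SET|.
Proof.
set J := possible_arcs n.
pose c (a : 'I_n * 'I_n) : R := (a.1 < a.2)%N%:R - r * (a.2 < a.1)%N%:R.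
(* Weights of an arc being present ([f]) or absent ([g]). The values 0 and 1 off [J] make every [G]
   not contained in [J] contribute 0 to the expanded product. *)
pose f a := if a \in J then p * expR (t * c a) else 0.
pose g a : R := if a \in J then 1 - p else 1.
rewrite -prod_forward_backward.
transitivity (\prod_(a : 'I_n * 'I_n) (f a + g a)); last first.
  apply: eq_bigr => a _; rewrite /f /g /c inE -val_eqE /=.
  case: ltngtP => _ /=; rewrite ?mulr0 ?subr0 ?mulr1 ?sub0r ?add0r// addrC//.
  by rewrite mulrN [t * r]mulrC.
rewrite bigA_distr big_mkcond; apply: eq_bigr => G _.
case: ifPn => [/fintype.subsetP GJ|/fintype.subsetPn[a aG aJ]]; last first.
  by rewrite (bigD1 a)//= aG /f (negbTE aJ) mul0r.
rewrite big_if /= mulrAC; congr (_ * _).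
  rewrite -arc_score_sum mulr_sumr expR_sum -prodr_const -big_split /=.
  by apply: eq_bigr => a aG; rewrite /f GJ.
rewrite -prodr_const [LHS]big_mkcond [RHS]big_mkcond; apply: eq_bigr => a _.
by rewrite inE /g; case: (a \in G).
Qed.

(** * The Chernoff bound *)

Theorem theorem4p1 (R : realType) (d : measure_display) (T : measurableType d)
    (P : probability T R) (n : nat) (p eps : R) (D : T -> {set 'I_n * 'I_n})
    (hn : (2 <= n)%N) (hp0 : 0 < p) (hp : p <= 1 / 2) (heps : 0 <= eps)
    (hD : random_digraph P p D) :
  let K : R := (n%:R ^+ 2 - n%:R) / 2 in
  let q : R := 1 - p in
  let r : R := 1 + eps in
  let X : T -> R := fun w => (forward_arcs (D w))%:R in
  let Y : T -> R := fun w => (backward_arcs (D w))%:R in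
  (P [set w | (0 <= X w - r * Y w)%R]
     <= (expR (- (p / (2 * q) * (K * eps ^+ 2 / (1 + r ^+ 2)))))%:E)%E.
Proof.
lazy beta zeta.
set K := (n%:R ^+ 2 - n%:R) / 2; set q := 1 - p; set r := 1 + eps.
set J := possible_arcs n.
have q0 : 0 < q by rewrite /q; lra.
have r0 : 0 < 1 + r ^+ 2 by rewrite ltr_wpDr ?sqr_ge0.
pose t := eps / (q * (1 + r ^+ 2)).
have t0 : 0 <= t by rewrite divr_ge0// mulr_ge0// ltW.
have tE : t * (q * (1 + r ^+ 2)) = eps by rewrite divfK// mulf_neq0// lt0r_neq0.
pose Z (G : {set 'I_n * 'I_n}) : R := (forward_arcs G)%:R - r * (backward_arcs G)%:R.
have -> : [set w |
    0 <= (forward_arcs (D w))%:R - r * (backward_arcs (D w))%:R] =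
  \bigcup_(G in [set` [pred G : {set 'I_n * 'I_n} | (G \subset J) && (0 <= Z G)]])
    [set w | D w = G].
  apply/seteqP; split => [w /= Zw|w [G /= /andP[_ ZG] DG]]; last by rewrite DG.
  have [DJ _ _] := hD.
  by exists (D w) => //=; apply/andP; split; [exact: DJ|exact: Zw].
(* The events D = G are disjoint, so nothing is lost here. *)
apply: le_trans (union_bound _ _ _ _) _ => /=.
  by move=> G /andP[GJ _]; have [] := digraph_law hD GJ.
rewrite (eq_bigr (fun G : {set _} => (p ^+ #|G| * q ^+ #|J :\: G|)%:E)); last first.
  by move=> G /andP[GJ _]; have [] := digraph_law hD GJ.
rewrite sumEFin lee_fin.
have w0 (G : {set 'I_n * 'I_n}) : 0 <= p ^+ #|G| * q ^+ #|J :\: G|.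
  by rewrite mulr_ge0// exprn_ge0// ltW.
(* Markov's inequality: the indicator of Z >= 0 is at most exp(t Z). *)
apply: (@le_trans _ _ (\sum_(G : {set 'I_n * 'I_n} | G \subset J)
    p ^+ #|G| * q ^+ #|J :\: G| * expR (t * Z G))).
  rewrite big_mkcondr; apply: ler_sum => G GJ; case: ifPn => ZG.
    by rewrite ler_peMr// -expR0 ler_expR mulr_ge0.
  by rewrite mulr_ge0 ?expR_ge0.
rewrite digraph_mgf.
set k := #|_|.
have mgf0 : 0 <= (1 - p + p * expR t) * (1 - p + p * expR (- (r * t))).
  apply: mulr_ge0; apply: addr_ge0 (ltW q0) _.
    by rewrite mulr_ge0 ?expR_ge0 ?ltW.
  by rewrite mulr_ge0 ?expR_ge0 ?ltW.
apply: le_trans (lerXn2r _ _ _ (mgf_le hp0 hp heps t0 tE)) _.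
- by rewrite nnegrE.
- by rewrite nnegrE expR_ge0.
rewrite -expRM_natl ler_expR /k card_forward -/K le_eqVlt; apply/orP; left.
apply/eqP; rewrite /t; field.
by rewrite !lt0r_neq0.
Qed.
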